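(* Let $f:C\times C\to\mathbb{R}$ be a bifunction and let $K:C\rightrightarrows C$ be a set-valued map, where $C$ is a compact, convex and nonempty subset of a Hausdorff locally convex real topological vector space $X$. Suppose that the following hold: (i) $K$ is closed and lower semicontinuous with convex values; (ii) for every $y\in C$, the set $\{x\in C: f(x,y)\geq 0\}$ is convex; (iii) for any subset $\{x_1,\dots,x_n\}$ of $C$ and any $x\in \mathrm{co}(\{x_1,\dots,x_n\})$, one has $\max_{i=1,\dots,n} f(x,x_i)\geq 0$; (iv) the set $\{(x,y)\in C\times C: f(x,y)\geq 0\}$ is closed. Then $\mathrm{QEP}(f,K)$ is nonempty; that is, there exists $x\in C$ such that $x\in K(x)$ and $f(x,y)\geq 0$ for all $y\in K(x)$.
   Context: A set-valued map $K:C\rightrightarrows C$ assigns to each $x\in C$ a subset $K(x)\subseteq C$. It is closed if its graph $\{(x,y)\in C\times C: y\in K(x)\}$ is closed in $C\times C$. It is lower semicontinuous if for every open set $V$ the set $\{x\in C: K(x)\cap V\neq\emptyset\}$ is open in $C$. The convex hull of a set $A$ is denoted $\mathrm{co}(A)$. The quasi-equilibrium problem associated with $f$ and $K$ consists in finding $x\in K(x)$ such that $f(x,y)\geq 0$ for all $y\in K(x)$; its solution set is denoted $\mathrm{QEP}(f,K)$.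
   Formalization: The values K(x) are assumed nonempty for every x in C; without this the claim fails (C={0}, f=0, K(0)=∅), and under (i) with C connected the only excluded case is K empty everywhere, where QEP(f,K) is empty. *)

(* Defs.v *)
From HB Require Import structures.
From mathcomp Require Import all_boot all_order all_algebra.
From mathcomp Require Import all_classical all_reals all_analysis.

Set Implicit Arguments.
Unset Strict Implicit.
Unset Printing Implicit Defensive.

Import Order.TTheory GRing.Theory Num.Theory.

Local Open Scope classical_set_scope.
Local Open Scope ring_scope.

(* A map defined on C only is represented by a total function on the ambient
   space.  Every notion below looks at arguments in C only, so the values
   elsewhere are irrelevant.  "Open (closed) in C" is openness (closedness) in
   the library's subspace topology. *)

Definition set_valued_map (T : Type) (C : set T) (K : T -> set T) : Prop :=
  forall x, C x -> K x `<=` C.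

Definition closed_map (T : topologicalType) (C : set T) (K : T -> set T) :
    Prop :=
  closed ([set p : T * T | (C `*` C) p /\ K p.1 p.2]
            : set (subspace (C `*` C))).

Definition lower_semicontinuous_map (T : topologicalType) (C : set T)
    (K : T -> set T) : Prop :=
  forall V : set T, open V ->
    open ([set x | C x /\ K x `&` V !=set0] : set (subspace C)).

Definition convex_hull (R : numDomainType) (X : lmodType R) (A : set X) :
    set X :=
  smallest (@convex_set R X) A.

Definition QEP (R : numDomainType) (T : Type) (C : set T) (f : T -> T -> R)
    (K : T -> set T) : set T :=
  [set x | [/\ C x, K x x & forall y, K x y -> 0 <= f x y]].

(* Main.v *)
Require Import Defs.
From HB Require Import structures.
From mathcomp Require Import all_boot all_order all_algebra.
From mathcomp Require Import all_classical all_reals all_analysis.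
From mathcomp Require Import zify lra.

Set Implicit Arguments.
Unset Strict Implicit.
Unset Printing Implicit Defensive.

Import Order.TTheory GRing.Theory Num.Theory.
Import numFieldNormedType.Exports.

(** For [x] in [C] let [M x] be the set of the [z] in [K x] with [0 <= f z y]
    for all [y] in [K x].  A fixed point of [M] is a solution, so the theorem
    follows from the Fan-Glicksberg fixed point theorem ([fan_glicksberg]) once
    [M] has nonempty convex values and a closed graph.
    - [M x] is nonempty by Ky Fan's version of the KKM lemma ([ky_fan_kkm])
      applied in the compact convex set [K x] to the closed sets
      [{z | 0 <= f z y}]: the hypothesis on the maximum says exactly that they
      satisfy the KKM covering condition.
    - [M x] is convex because [K x] and the sets [{z | 0 <= f z y}] are.
    - The graph of [M] is closed: if [(x, z)] is a limit of points [(x', z')]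
      of the graph and [y] lies in [K x], lower semicontinuity gives points
      [y'] of [K x'] near [y], and [0 <= f z' y'] passes to the limit.

    Both general theorems come from one fact about the standard simplex,
    [simplex_labelling]: however its points are labelled by vertices, some
    point [p] is such that each vertex on which [p] has positive weight occurs
    as a label arbitrarily near [p].
    - For Fan-Glicksberg, cover [C] by finitely many translates [x_i + W] of a
      small convex neighbourhood of 0 and label [p] by an [i] such that
      [M (sum p_i x_i)] meets [x_i + W].  At the special point [p], with
      [a = sum p_i x_i], each [x_i] of positive weight is the closure of [W]
      away from a point [y_i] of [M a]; by convexity [a] is equally close to
      the point [sum p_i y_i] of [M a].  Compactness turns approximate fixed
      points into a fixed point.
    - For KKM, if the closed sets [G_i] do not come simultaneously within [e]
      of any point, label [p] by an [i] such that [G_i] stays [e]-away from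
      [p].  The special point then avoids every [G_i] of positive weight.

    The labelling fact is the limit of a statement on the grid of the points
    with coordinates in [N^-1 * nat] ([grid_labelling]), which is an instance
    of Scarf's combinatorial lemma ([scarf]).  Scarf's lemma replaces the
    triangulation in Sperner's lemma by sets that are dominant for a family of
    linear orders, one for each vertex; the parity argument stays the same. *)

(** * Scarf's lemma on dominant sets *)

(** When a map loses exactly one element, exactly two elements can be removed
    without changing the image: the two that collide.  This yields both counts
    in the door-and-room argument below, once for colours and once for the
    orders. *)
Lemma card_pigeonhole_pair (aT rT : finType) (f : aT -> rT) (A : {set aT}) :
  #|A| = #|f @: A|.+1 ->
  exists a b, [/\ a \in A, b \in A, a != b, f a = f b &
    forall x, x \in A -> (f @: (A :\ x) == f @: A) = (x == a) || (x == b)].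
Proof.
move=> cardA.
have [a [b [aA bA ab fab]]] : exists a b,
    [/\ a \in A, b \in A, a != b & f a = f b].
  have /dinjectivePn[a aA [b /andP[ba bA] fab]] : ~~ dinjectiveb f (mem A).
    apply/negP => /dinjectiveP finj.
    have : #|f @: A| = #|A| by apply: card_in_imset.
    by rewrite cardA; lia.
  by exists a, b; rewrite eq_sym ba.
have drop x y : x \in A -> y \in A -> x != y -> f x = f y ->
    f @: (A :\ x) = f @: A.
  move=> xA yA xy fxy; apply/eqP; rewrite finset.eqEsubset imsetS ?subD1set //=.
  apply/fintype.subsetP => _ /imsetP[z zA ->].
  have [->|zx] := eqVneq z x; last by apply: imset_f; rewrite !inE zx.
  by rewrite fxy; apply: imset_f; rewrite !inE eq_sym xy.
exists a, b; split=> // x xA.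
apply/eqP/orP => [fAx|[/eqP->|/eqP->]]; last 2 first.
- exact: drop ab fab.
- by apply: drop aA _ _; rewrite // eq_sym.
have /imset_injP finj : #|f @: (A :\ x)| == #|A :\ x|.
  by move: cardA; rewrite fAx (cardsD1 x A) xA; lia.
have [_|xa] := eqVneq x a; first by left.
have [_|xb] := eqVneq x b; first by right.
by case/eqP: ab; apply: finj; rewrite ?inE // eq_sym ?xa ?xb.
Qed.

Section Scarf.
(* The injective ranks [r i] encode linear orders on [U]; [s i] are the slack
   points, which play the part of the vertices of the big simplex. *)
Variables (I U : finType) (r : I -> U -> nat) (s : I -> U).
Hypothesis r_inj : forall i, injective (r i).

(** The sets of size [#|I|] with this property replace the cells of a
    triangulation, and those with one element less replace their facets. *)
Definition dominant (S : {set U}) : bool :=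
  [forall y, exists i, [forall x in S, r i y <= r i x]].

Lemma dominantP (S : {set U}) :
  reflect (forall y, exists i, forall x, x \in S -> r i y <= r i x)
          (dominant S).
Proof.
apply: (iffP forallP) => dS y; have := dS y.
  by case/existsP => i /forall_inP ?; exists i.
by case=> i ?; apply/existsP; exists i; apply/forall_inP.
Qed.

Lemma dominant_sub (S S' : {set U}) :
  S' \subset S -> dominant S -> dominant S'.
Proof.
move=> /fintype.subsetP sub /dominantP dS; apply/dominantP => y.
by have [i yS] := dS y; exists i => x /sub; apply: yS.
Qed.

Definition lowest (S : {set U}) (i : I) : U :=
  odflt (s i) [pick x in S | [forall z in S, r i x <= r i z]].

Lemma lowestP (S : {set U}) i : S != finset.set0 ->
  lowest S i \in S /\ forall z, z \in S -> r i (lowest S i) <= r i z.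
Proof.
case/set0Pn => x0 x0S; rewrite /lowest.
case: pickP => [x /andP[xS /forall_inP]|] //=.
case: (arg_minnP (r i) x0S) => x xS xmin /(_ x) /negP; case.
by rewrite [_ \in S]xS; apply/forall_inP.
Qed.

Lemma lowest_eq (S : {set U}) i x :
  x \in S -> (forall z, z \in S -> r i x <= r i z) -> lowest S i = x.
Proof.
move=> xS xmin; have [|lS lmin] := @lowestP S i.
  by apply/set0Pn; exists x.
by apply: (r_inj (i := i)); apply/eqP; rewrite eqn_leq lmin // xmin.
Qed.

(** Testing dominance on a point of [S] itself shows that it is the lowest one
    for some order. *)
Lemma dominant_lowest (S : {set U}) :
  S != finset.set0 -> dominant S -> lowest S @: [set: I] = S.
Proof.
move=> S0 /dominantP dS; apply/eqP; rewrite finset.eqEsubset; apply/andP; split.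
  by apply/fintype.subsetP => _ /imsetP[i _ ->]; case: (lowestP i S0).
apply/fintype.subsetP => y yS; have [i yi] := dS y.
by apply/imsetP; exists i; rewrite // (lowest_eq yS).
Qed.

Hypothesis s_lowest : forall i u, r i (s i) <= r i u.
Hypothesis s_high :
  forall i k u, u \notin codom s -> k != i -> r k u < r k (s i).

(** In a door [D] one point is lowest for two orders [i] and [j], and every
    other point for one order only.  A room [x |: D] arises by relieving [D] of
    one of the two, that is, by taking for [x] the highest point, in the order
    [i] (resp. [j]), among those above [D] in all other orders.  As soon as [D]
    has a point that is not a slack point, such an [x] exists for both, and [D]
    belongs to exactly two rooms. *)
Section Door.
Variable D : {set U}.
Hypothesis domD : dominant D.
Hypothesis cardD : #|D|.+1 = #|I|.
Variable u : U.
Hypotheses (uD : u \in D) (uNs : u \notin codom s).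

Let D0 : D != finset.set0. Proof. by apply/set0Pn; exists u. Qed.

Definition above (k : I) : {set U} :=
  [set y | [forall (l | l != k), r l (lowest D l) < r l y]].

Lemma aboveP k y :
  reflect (forall l, l != k -> r l (lowest D l) < r l y) (y \in above k).
Proof. by rewrite inE; apply: (iffP forall_inP). Qed.

(** The high slack points guarantee a candidate for every order, so that no
    room is missing when [D] has a point outside the slack points. *)
Lemma slack_above k : s k \in above k.
Proof.
apply/aboveP => l lk; apply: leq_ltn_trans (s_high uNs lk).
by have [_] := lowestP l D0; apply.
Qed.

Lemma above_le k y : y \in above k -> forall x, x \in D -> r k y <= r k x.
Proof.
move=> /aboveP yk; have [l yl] := (dominantP _ domD) y.
have [<- //|lk] := eqVneq l k.
have [lD _] := lowestP l D0.
by have := yl _ lD; rewrite leqNgt yk.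
Qed.

Definition top (k : I) : U := [arg max_(x > s k in above k) r k x].

Lemma topP k :
  top k \in above k /\ forall y, y \in above k -> r k y <= r k (top k).
Proof. by rewrite /top; case: arg_maxnP => //; exact: slack_above. Qed.

Lemma top_room k : lowest D @: ([set: I] :\ k) = D ->
  top k \notin D /\ dominant (top k |: D).
Proof.
move=> lowD; have [ta tmax] := topP k; have /aboveP tk := ta; split.
  apply/negP; rewrite -{1}lowD => /imsetP[l]; rewrite !inE andbT => lk tl.
  by have := tk _ lk; rewrite -tl ltnn.
apply/dominantP => y; have [ya|] := boolP (y \in above k).
  exists k => x /setU1P[->|xD]; first exact: tmax.
  exact: leq_trans (tmax _ ya) (above_le ta xD).
rewrite inE => /forall_inPn[l lk]; rewrite -leqNgt => yl; exists l => x.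
case/setU1P => [->|xD]; first exact: leq_trans yl (ltnW (tk _ lk)).
by apply: leq_trans yl _; have [_] := lowestP l D0; apply.
Qed.

Lemma room_top x : x \notin D -> dominant (x |: D) ->
  exists2 k, lowest D @: ([set: I] :\ k) = D & x = top k.
Proof.
move=> xD domS; set S := x |: D.
have S0 : S != finset.set0 by apply/set0Pn; exists x; rewrite !inE eqxx.
have xS : x \in S by rewrite !inE eqxx.
have lowS := dominant_lowest S0 domS.
have linj : {in [set: I] &, injective (lowest S)}.
  by apply/imset_injP; rewrite lowS cardsT cardsU1 xD -cardD; lia.
have [k _ xk] : exists2 k, k \in [set: I] & x = lowest S k.
  by apply/imsetP; rewrite lowS.
have lowDS l : l != k -> lowest D l = lowest S l.
  move=> lk; have [lS lmin] := lowestP l S0.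
  apply: lowest_eq => [|z zD]; last by apply: lmin; rewrite !inE zD orbT.
  case/setU1P: lS => // lx; case/eqP: lk; apply: linj; rewrite ?inE //.
  by rewrite lx.
have xa : x \in above k.
  apply/aboveP => l lk; rewrite lowDS // ltn_neqAle.
  have [_ -> //] := lowestP l S0; rewrite andbT.
  apply/eqP => /r_inj; rewrite xk => /linj ll.
  by case/eqP: lk; apply: ll; rewrite inE.
exists k.
  apply/eqP; rewrite finset.eqEsubset; apply/andP; split.
    by apply/fintype.subsetP => _ /imsetP[l _ ->]; have [] := lowestP l D0.
  apply/fintype.subsetP => y yD.
  have /imsetP[l _ yl] : y \in lowest S @: [set: I].
    by rewrite lowS !inE yD orbT.
  have lk : l != k by apply: contraNneq xD => lk; rewrite xk -lk -yl.
  by apply/imsetP; exists l; rewrite ?inE ?lk // lowDS.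
have [ta tmax] := topP k; apply: (r_inj (i := k)); apply/eqP.
rewrite eqn_leq tmax //=; have [l tl] := (dominantP _ domS) (top k).
case: (eqVneq l k) tl => [-> tl|lk tl].
  by apply: tl; rewrite !inE eqxx.
have [lD _] := lowestP l D0; have := tl (lowest D l).
rewrite !inE lD orbT => /(_ isT).
by move/aboveP: ta => /(_ _ lk); rewrite ltnNge => /negbTE ->.
Qed.

Lemma card_rooms_inner_door :
  #|[set x | (x \notin D) && dominant (x |: D)]| = 2.
Proof.
have lowD := dominant_lowest D0 domD.
have [|i [j [_ _ ij lij pairP]]] :=
    @card_pigeonhole_pair _ _ (lowest D) [set: I].
  by rewrite lowD cardsT cardD.
have lowDP k : reflect (lowest D @: ([set: I] :\ k) = D) ((k == i) || (k == j)).
  by rewrite -pairP ?inE // lowD; apply: eqP.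
have -> : [set x | (x \notin D) && dominant (x |: D)] = [set top i; top j].
  apply/setP => x; rewrite !inE; apply/andP/orP => [[xD domS]|].
    have [k /lowDP/orP[]/eqP-> ->] := room_top xD domS; by [left|right].
  by case=> /eqP ->; apply: top_room; apply/lowDP; rewrite eqxx ?orbT.
have tij : top i != top j.
  apply/eqP => tE; have [ti _] := topP i; have [tj _] := topP j.
  move/aboveP: ti => /(_ j); rewrite eq_sym ij => /(_ isT).
  by rewrite ltnNge tE above_le //; have [] := lowestP j D0.
by rewrite cards2 tij.
Qed.

End Door.

Variables (c : U -> I) (i0 : I) (u0 : U).
Hypothesis cs : cancel s c.
Hypothesis u0Ns : u0 \notin codom s.

(** The only door that belongs to a single room, like the facet of a simplex
    opposite to a vertex. *)
Definition outer_door : {set U} := s @: [set~ i0].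

Let slack_le l y : y \notin codom s -> r l y <= r l (s l) -> False.
Proof.
move=> yNs le; case/negP: yNs; suff -> : y = s l by exact: codom_f.
by apply: (r_inj (i := l)); apply/eqP; rewrite eqn_leq le s_lowest.
Qed.

Lemma card_rooms_outer_door :
  #|[set x | (x \notin outer_door) && dominant (x |: outer_door)]| = 1.
Proof.
have [t /= tNs tmax] :=
  arg_maxnP (P := [pred x | x \notin codom s]) (r i0) u0Ns.
apply/eqP/cards1P; exists t; apply/setP => x; rewrite !inE.
apply/andP/eqP => [[xD /dominantP domS]|->{x}].
  have dom y : y \notin codom s -> r i0 y <= r i0 x.
    move=> yNs; have [l yl] := domS y.
    have [<-|li0] := eqVneq l i0; first by apply: yl; rewrite !inE eqxx.
    case: (@slack_le l y yNs); apply: yl; rewrite !inE imset_f ?orbT //.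
    by rewrite !inE.
  have xNs : x \notin codom s.
    apply/negP => /codomP[l xl]; have [li|li] := eqVneq l i0.
      by apply: (@slack_le i0 u0 u0Ns); rewrite -[in s _]li -xl; exact: dom.
    by case/negP: xD; rewrite xl imset_f ?inE.
  apply: (r_inj (i := i0)); apply/eqP; rewrite eqn_leq dom // andbT.
  exact: tmax.
split.
  by apply/negP => /imsetP[l _ tl]; case/negP: tNs; rewrite tl codom_f.
apply/dominantP => y; have [/codomP[l ->]|yNs] := boolP (y \in codom s).
  by exists l => x _; exact: s_lowest.
exists i0 => x /setU1P[->|/imsetP[l]]; first exact: tmax.
by rewrite !inE => li ->; apply/ltnW/s_high; rewrite // eq_sym.
Qed.

(** Count the pairs of a room and a door in it, where a door carries all colours
    but [i0].  A room that does not carry all colours has 0 or 2 such doors, by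
    [card_pigeonhole_pair] for the colours.  A door lies in 2 rooms, except the
    outer one, which lies in 1.  If no room carried all colours, the number of
    pairs would be both even and odd. *)
Theorem scarf : exists S : {set U},
  [/\ dominant S, #|S| = #|I| & c @: S = [set: I]].
Proof.
pose rooms := [set S : {set U} | dominant S && (#|S| == #|I|)].
pose doors :=
  [set D : {set U} | [&& dominant D, #|D|.+1 == #|I| & c @: D == [set~ i0]]].
have [/existsP[S /andP[]]|/existsPn nofull] :=
    boolP [exists S, (S \in rooms) && (c @: S == [set: I])].
  by rewrite inE => /andP[dS /eqP cS] /eqP fS; exists S.
have outer : outer_door \in doors.
  rewrite inE; apply/and3P; split.
  - have [t] : exists t,
        t \in [set x | (x \notin outer_door) && dominant (x |: outer_door)].
      by apply/card_gt0P; rewrite card_rooms_outer_door.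
    by rewrite inE => /andP[_]; apply: dominant_sub; exact: finset.subsetUr.
  - rewrite card_imset ?cardsC1; last exact: can_inj cs.
    by rewrite prednK //; apply/card_gt0P; exists i0.
  - by rewrite -imset_comp (eq_imset (g := id)) ?imset_id //; exact: cs.
(* double counting, for each fixed removed point [x] *)
have flip : \sum_(S in rooms) #|[set x in S | S :\ x \in doors]| =
    \sum_(D in doors) #|[set x | (x \notin D) && (x |: D \in rooms)]|.
  rewrite (eq_bigr (fun S : {set U} =>
    \sum_x ((x \in S) && (S :\ x \in doors) : nat))); last first.
    move=> S _; rewrite -sum1_card big_mkcond.
    by apply: eq_bigr => x _; rewrite inE; case: ifP.
  rewrite [RHS](eq_bigr (fun D : {set U} =>
    \sum_x ((x \notin D) && (x |: D \in rooms) : nat))); last first.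
    move=> S _; rewrite -sum1_card big_mkcond.
    by apply: eq_bigr => x _; rewrite inE; case: ifP.
  rewrite exchange_big [RHS]exchange_big /=; apply: eq_bigr => x _.
  rewrite -!big_mkcondr !sum1dep_card.
  set A := [set S | _]; set B := [set D | _].
  have -> : B = (fun S : {set U} => S :\ x) @: A.
    apply/setP => D; rewrite inE; apply/and3P/imsetP => [[Dd xD Dr]|[S]].
      exists (x |: D); rewrite ?setU1K //.
      by rewrite inE Dr finset.setU1K // Dd !inE eqxx.
    rewrite inE => /and3P[Sr xS Sd] ->.
    by rewrite Sd finset.setD1K // Sr !inE eqxx.
  rewrite card_in_imset // => S S'.
  rewrite !inE => /and3P[_ xS _] /and3P[_ xS' _] SS'.
  by rewrite -(finset.setD1K xS) SS' finset.setD1K.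
have : 2 %| \sum_(S in rooms) #|[set x in S | S :\ x \in doors]|.
  apply: dvdn_sum => S Sr.
  have /andP[dS /eqP cardS] : dominant S && (#|S| == #|I|) by rewrite inE in Sr.
  have -> : [set x in S | S :\ x \in doors] =
      [set x in S | c @: (S :\ x) == [set~ i0]].
    apply/setP => x; rewrite !inE; case xS: (x \in S) => //=.
    rewrite (dominant_sub (subD1set S x) dS) /=.
    by have := cardsD1 x S; rewrite xS cardS add1n => ->; rewrite eqxx.
  have [cS|cS] := eqVneq (c @: S) [set~ i0].
    have [|a [b [aS bS ab _ pairP]]] := @card_pigeonhole_pair _ _ c S.
      by rewrite cS cardS cardsC1 prednK //; apply/card_gt0P; exists i0.
    have -> : [set x in S | c @: (S :\ x) == [set~ i0]] = [set a; b].
      apply/setP => x; rewrite !inE; case xS: (x \in S).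
        by rewrite -cS pairP.
      by apply/esym/negP => /orP[]/eqP xE; rewrite xE ?aS ?bS in xS.
    by rewrite cards2 ab.
  suff -> : [set x in S | c @: (S :\ x) == [set~ i0]] = finset.set0.
    by rewrite cards0.
  apply/setP => x; rewrite !inE; apply/negP => /andP[xS /eqP cSx].
  have sub : [set~ i0] \subset c @: S by rewrite -cSx imsetS // subD1set.
  have [i0S|i0S] := boolP (i0 \in c @: S).
    case/negP: (nofull S); rewrite Sr /= finset.eqEsubset finset.subsetT /=.
    apply/fintype.subsetP => i _; have [-> //|ii0] := eqVneq i i0.
    by apply: (fintype.subsetP sub); rewrite !inE.
  case/eqP: cS; apply/eqP; rewrite finset.eqEsubset sub andbT.
  by apply/fintype.subsetP => i iS; rewrite !inE; apply: contraNneq i0S => <-.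
have roomE (D : {set U}) : D \in doors ->
    [set x | (x \notin D) && (x |: D \in rooms)] =
    [set x | (x \notin D) && dominant (x |: D)].
  rewrite inE => /and3P[_ /eqP cD _]; apply/setP => x; rewrite !inE.
  by case xD: (x \in D) => //=; rewrite cardsU1 xD -cD eqxx andbT.
rewrite flip (bigD1 outer_door) //= roomE // card_rooms_outer_door.
rewrite dvdn_addl // dvdn_sum // => D /andP[Dd Dout]; rewrite roomE //.
move: (Dd); rewrite inE => /and3P[dD /eqP cD /eqP colD].
have [/existsP[u /andP[uD uNs]]|/existsPn noNs] :=
    boolP [exists u, (u \in D) && (u \notin codom s)].
  by rewrite (card_rooms_inner_door dD cD uD uNs).
have slackD u : u \in D -> u = s (c u).
  by move=> uD; have := noNs u; rewrite uD negbK => /codomP[l ->]; rewrite cs.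
case/eqP: Dout; rewrite /outer_door -colD -imset_comp; apply/setP => u.
apply/idP/imsetP => [uD|[v vD ->]]; first by exists u; rewrite //= -slackD.
by rewrite /= -slackD.
Qed.

End Scarf.

(** * Labellings of the simplex *)

(** The points of Scarf's lemma are the grid points, ordered by each coordinate
    (ties are broken by an enumeration), together with the slack points; [C]
    is the set of the coordinates whose slack point is missing from the
    dominant set.  A grid point exceeding the minima of that set in all
    coordinates of [C] would contradict dominance, so these minima sum up to
    at least [N - n]: the points of the set are close to each other, and
    almost all their weight is on [C]. *)
Lemma grid_labelling (n N : nat) (l : {ffun 'I_n.+1 -> 'I_N.+1} -> 'I_n.+1) :
  exists (C : {set 'I_n.+1}) (v : 'I_n.+1 -> {ffun 'I_n.+1 -> 'I_N.+1}),
  [/\ C != finset.set0,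
      forall i, i \in C -> \sum_k v i k = N /\ l (v i) = i,
      forall i j k, i \in C -> j \in C -> v i k <= v j k + n &
      forall i k, i \in C -> k \notin C -> v i k <= n].
Proof.
pose I := 'I_n.+1.
pose T : finType := {t : {ffun I -> 'I_N.+1} | \sum_k t k == N}.
have t0P : \sum_k
    [ffun i : I => if i == ord0 then ord_max else ord0 : 'I_N.+1] k == N.
  rewrite (bigD1 ord0) //= ffunE eqxx big1 ?addn0 //= => i /negbTE i0.
  by rewrite ffunE i0.
pose grid (t : {ffun I -> 'I_N.+1}) (tP : \sum_k t k == N) : T :=
  exist (fun t : {ffun I -> 'I_N.+1} => is_true (\sum_k t k == N)) t tP.
pose t0 := grid _ t0P.
have [M [rk [rk_inj rk_lt]]] :
    exists M (rk : T -> nat), injective rk /\ forall t, rk t < M.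
  exists #|T|, (fun t => nat_of_ord (enum_rank t)).
  split=> [|t]; last exact: ltn_ord.
  by move=> t t' /val_inj; exact: enum_rank_inj.
(* order [i]: slack point [i] is the lowest, the others lie above the grid *)
pose r (i : I) (u : T + I) : nat := match u with
  | inl t => (sval t i * M + rk t).+1
  | inr k => if k == i then 0 else (N.+1 * M).+1 + k
  end.
have r_lt i (t : T) : r i (inl t) < (N.+1 * M).+1.
  rewrite /= ltnS mulSn addnC -addSn leq_add ?rk_lt //.
  by rewrite leq_mul2r -ltnS ltn_ord orbT.
have r_inj i : injective (r i).
  move=> [t|k] [t'|k'] //.
  - by case=> E; congr inl; apply: rk_inj;
    rewrite -(modn_small (rk_lt t)) -(modnMDl (sval t i)) E modnMDl modn_small.
  - by have /= := r_lt i t; case: ifP => _ lt //= E; move: lt; rewrite E; lia.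
  - by have /= := r_lt i t'; case: ifP => _ lt //= E; move: lt; rewrite -E; lia.
  - move=> /=; case: eqP => [->|_]; case: eqP => [->|_] // E; try by lia.
    by congr inr; apply: val_inj => /=; lia.
pose c (u : T + I) : I := match u with inl t => l (sval t) | inr k => k end.
have inlN (t : T) : (inl t : T + I) \notin codom (@inr T I).
  by apply/negP => /codomP[].
have [||||S [domS _ cS]] :=
    @scarf I (T + I)%type r inr r_inj _ _ c ord0 (inl t0) _ _.
- by move=> i u /=; rewrite eqxx.
- move=> i k [t _|k' /negP[]]; last exact: codom_f.
  by rewrite eq_sym => /negbTE ik; have := r_lt k t => /=; rewrite ik; lia.
- by [].
- exact: inlN.
pose C := [set i : I | inr i \notin S].
have cells (y : T) : exists2 i, i \in C &
    forall t, inl t \in S -> sval y i <= sval t i.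
  have [i yi] := (dominantP _ _ domS) (inl y); exists i.
    by rewrite inE; apply/negP => /yi /=; rewrite eqxx.
  move=> t /yi le; rewrite leqNgt; apply/negP => ty; move: le; apply/negP.
  rewrite /= ltnS -ltnNge -addnS (leq_trans (n := (sval t i).+1 * M)) //.
    by rewrite mulSn addnC leq_add // rk_lt.
  by apply: leq_trans (leq_addr _ _); rewrite leq_mul2r ty orbT.
have [j jC _] := cells t0.
have pickC i : i \in C -> exists t : T, (inl t \in S) && (l (sval t) == i).
  rewrite inE => iS; have /imsetP[[t tS ->|k kS /= ik]] : i \in c @: S.
  - by rewrite cS inE.
  - by exists t; rewrite tS eqxx.
  - by rewrite ik kS in iS.
pose v i := if [pick t : T | (inl t \in S) && (l (sval t) == i)] is Some t
            then t else t0.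
have vP i : i \in C -> inl (v i) \in S /\ l (sval (v i)) = i.
  move=> /pickC[t tP]; rewrite /v; case: pickP => [t' /andP[? /eqP] //|/(_ t)].
  by rewrite tP.
pose m (i : I) : T := [arg min_(t < v j | inl t \in S) sval t i].
have mP i :
    inl (m i) \in S /\ forall t, inl t \in S -> sval (m i) i <= sval t i.
  by rewrite /m; case: arg_minnP; [case: (vP _ jC) | split].
have sumT (t : T) : \sum_k sval t k = N by apply/eqP; exact: (valP t).
have sum_gt : N < \sum_(i in C) (sval (m i) i).+1.
  rewrite ltnNge; apply/negP => le.
  (* raise every minimum by one and put what is left on one coordinate *)
  pose y0 i := (i \in C) * (sval (m i) i).+1 +
    (i == j) * (N - \sum_(i in C) (sval (m i) i).+1).
  have y0sum : \sum_i y0 i = N.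
    rewrite big_split /= [X in _ + X](bigD1 j) //= eqxx mul1n.
    rewrite [X in _ + (_ + X)]big1 ?addn0; last by move=> i /negbTE->.
    rewrite (eq_bigr (fun i => if i \in C then (sval (m i) i).+1 else 0)).
      by rewrite -big_mkcond /= subnKC.
    by move=> i _; case: ifP => _; rewrite ?mul1n.
  have y0le i : y0 i <= N by rewrite -y0sum (bigD1 i) //= leq_addr.
  have yP : \sum_k [ffun i : I => inord (y0 i) : 'I_N.+1] k == N.
    apply/eqP; rewrite -[RHS]y0sum; apply: eq_bigr => i _.
    by rewrite ffunE inordK // ltnS.
  have [i iC /(_ (m i))] := cells (grid _ yP).
  rewrite /= ffunE inordK ?ltnS // => /(_ (proj1 (mP i))).
  by rewrite /y0 iC mul1n leqNgt ltnS leq_addr.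
have cardC : #|C| <= n.+1 by apply: leq_trans (max_card _) _; rewrite card_ord.
have {}sum_gt : N < \sum_(i in C) sval (m i) i + #|C|.
  move: sum_gt; under eq_bigr do rewrite -addn1.
  by rewrite big_split /= sum1_card.
have arith_in a b x y z p q : q <= n.+1 -> b + y + z = p ->
    p < a + x + q -> x <= y -> b <= a + n by lia.
have arith_out b x y z p q : q <= n.+1 -> y + (b + z) = p ->
    p < x + q -> x <= y -> b <= n by lia.
have near_in (t : T) i : inl t \in S -> i \in C -> sval t i <= sval (m i) i + n.
  move=> tS iC; have := sumT t; rewrite (bigID (mem C)) /= (bigD1 i) //=.
  move: sum_gt; rewrite (bigD1 i) //=.
  have : \sum_(k in C | k != i) sval (m k) k <= \sum_(k in C | k != i) sval t k.
    by apply: leq_sum => k _; exact: (mP k).2.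
  move=> le1 lt2 eq3; move: cardC eq3 lt2 le1; exact: arith_in.
have near_out (t : T) k : inl t \in S -> k \notin C -> sval t k <= n.
  move=> tS kC; have := sumT t; rewrite (bigID (mem C)) /=.
  rewrite [X in _ + X](bigD1 k) //=; move: sum_gt.
  have : \sum_(k in C) sval (m k) k <= \sum_(k in C) sval t k.
    by apply: leq_sum => i _; exact: (mP i).2.
  move=> le1 lt2 eq3; move: cardC eq3 lt2 le1; exact: arith_out.
exists C, (fun i => sval (v i)); split.
- by apply/set0Pn; exists j.
- by move=> i /vP[_ ?]; split; first exact: sumT.
- move=> i i' k /vP[iS _] /vP[iS' _].
  have [kC|kC] := boolP (k \in C).
    apply: leq_trans (near_in _ _ iS kC) _.
    by rewrite leq_add2r; exact: (mP k).2.
  by apply: leq_trans (near_out _ _ iS kC) (leq_addl _ _).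
- by move=> i k /vP[iS _]; exact: near_out.
Qed.

Local Open Scope classical_set_scope.
Local Open Scope ring_scope.

(** Both limit arguments in the simplex have this form: the conditions [Q e]
    get sharper as [e] decreases, each is met at some point of a compact set,
    and a single point of that set is approached by points meeting conditions
    of arbitrary sharpness. *)
Lemma compact_approx (R : realType) (T : pseudoMetricType R) (D : set T)
    (Q : R -> T -> Prop) :
  compact D -> (forall e, 0 < e -> exists2 u, D u & Q e u) ->
  exists2 p, D p & forall e, 0 < e ->
    exists d u, [/\ 0 < d, d <= e, D u, Q d u & ball p e u].
Proof.
move=> Dcpt QD; pose d k : R := k.+1%:R^-1.
have d0 k : 0 < d k by rewrite invr_gt0 ltr0n.
pose u k := sval (cid2 (QD _ (d0 k))).
have uP k : D (u k) /\ Q (d k) (u k) by rewrite /u; case: cid2.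
have [|p [Dp clp]] := Dcpt (u @ \oo) _.
  by exists 0%N => // k _ /=; case: (uP k).
exists p => // e e0.
have small : (u @ \oo) [set u k | k in [set k | d k <= e]].
  have [N _ NP] := near_infty_natSinv_lt (PosNum e0).
  by exists N => // k Nk; exists k => //; exact/ltW/(NP k Nk).
have [_ [[k /= ke <-] pu]] := clp _ (ball p e) small (nbhsx_ballx p e e0).
by exists (d k), (u k); case: (uP k); split.
Qed.

Definition simplex (R : realType) (n : nat) : set 'rV[R]_n :=
  [set p | (forall i, 0 <= p ord0 i) /\ \sum_i p ord0 i = 1].

Section Simplex.
Variables (R : realType) (n : nat).
Local Notation simplex := (@simplex R n.+1).

Lemma simplex_le1 p i : simplex p -> p ord0 i <= 1.
Proof.
by move=> [p0 <-]; rewrite (bigD1 i) //= lerDl sumr_ge0.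
Qed.

Lemma simplex_support p : simplex p -> exists i, 0 < p ord0 i.
Proof.
move=> [p0 p1]; apply/existsP; apply: contraT => /existsPn ple0.
have := @oner_eq0 R; rewrite -p1 big1 ?eqxx // => i _.
by apply/eqP; rewrite eq_le p0 andbT leNgt.
Qed.

Lemma simplex_compact : compact simplex.
Proof.
apply: (@subclosed_compact _ _
    [set p : 'rV[R]_n.+1 | forall i, `[0, 1]%classic (p ord0 i)]).
- have -> : simplex = (\bigcap_i [set p | 0 <= p ord0 i]) `&`
      [set p | \sum_i p ord0 i = 1].
    apply/seteqP; split=> p [p0 p1]; split=> // i; first by move=> _; exact: p0.
    exact: p0.
  apply: closedI.
    apply: closed_bigI => i _.
    apply: (@preimage_closed _ _
      (fun p : 'rV[R]_n.+1 => p ord0 i) [set x | 0 <= x]).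
      by move=> p _; exact: coord_continuous.
    exact: closed_ge.
  apply: (@preimage_closed _ _
    (fun p : 'rV[R]_n.+1 => \sum_i p ord0 i) [set 1]).
    move=> p _; apply: continuous_big => [|i _]; first exact: add_continuous.
    exact: coord_continuous.
  exact: closed_eq.
- apply: (@rV_compact R _ (fun=> `[0, 1]%classic)) => _.
  exact: segment_compact.
- move=> p sp i /=; rewrite in_itv /= simplex_le1 // andbT; exact: sp.1.
Qed.

Lemma rV_ball (p q : 'rV[R]_n.+1) e :
  0 < e -> (forall i, `|p ord0 i - q ord0 i| < e) -> ball p e q.
Proof. by move=> e0 pq; split=> // i j; rewrite ord1; exact: pq. Qed.

(** Unlike in Sperner's lemma, the labels are arbitrary; in return, only the
    indices of the support of [p] are claimed to occur near [p].  On a fine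
    grid, the points given by [grid_labelling] are [e]-close to each other, and
    a coordinate of size at least [e] has to lie in [C], hence is a label. *)
Theorem simplex_labelling (l : 'rV[R]_n.+1 -> 'I_n.+1) :
  exists2 p, simplex p & forall i, 0 < p ord0 i ->
    closure [set q | simplex q /\ l q = i] p.
Proof.
pose Q e (u : 'rV[R]_n.+1) := forall i, e <= u ord0 i ->
  exists q, [/\ simplex q, l q = i & ball u e q].
have [|p sp pQ] := @compact_approx R _ simplex Q simplex_compact.
  move=> e e0.
  (* the grid lemma controls distances and stray weights up to [n / N.+1] *)
  have [N Ne] : exists N, n%:R / N.+1%:R < e.
    have ne0 : 0 < e / n.+1%:R by rewrite divr_gt0.
    have [N _ /(_ N (leqnn N))] := near_infty_natSinv_lt (PosNum ne0).
    rewrite /= ltr_pdivlMr // => Ne; exists N.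
    rewrite mulrC; apply: le_lt_trans Ne.
    by rewrite ler_wpM2l // ler_nat.
  pose pt (t : {ffun 'I_n.+1 -> 'I_N.+2}) : 'rV[R]_n.+1 :=
    \row_i ((t i)%:R / N.+1%:R).
  have N0 : N.+1%:R != 0 :> R by rewrite pnatr_eq0.
  have ptP (t : {ffun 'I_n.+1 -> 'I_N.+2}) :
      (\sum_k t k = N.+1)%N -> simplex (pt t).
    move=> tN; split=> [i|]; first by rewrite mxE divr_ge0.
    by under eq_bigr do rewrite mxE; rewrite -mulr_suml -natr_sum tN divff.
  have [C [v [C0 vP v_near v_out]]] := grid_labelling (l \o pt).
  have /set0Pn[j jC] := C0; exists (pt (v j)).
    by apply: ptP; case: (vP j jC).
  have small : (forall k : nat, (k <= n)%N -> k%:R / N.+1%:R < e).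
    move=> k kn; apply: le_lt_trans Ne.
    by rewrite ler_wpM2r ?invr_ge0 // ler_nat.
  move=> i; rewrite mxE => ei; have iC : i \in C.
    by apply: contraTT ei => iC; rewrite -ltNge small // v_out.
  have [vN vl] := vP i iC; exists (pt (v i)); split=> //; first exact: ptP.
  apply: rV_ball => // k; rewrite !mxE -mulrBl normrM.
  rewrite [X in _ * X]ger0_norm ?invr_ge0 //.
  have [le|/ltnW le] := leqP (v i k) (v j k).
    by rewrite -natrB // ger0_norm // small // leq_subLR v_near.
  by rewrite distrC -natrB // ger0_norm // small // leq_subLR v_near.
exists p => // i pi0 B /nbhs_ballP[e e0 eB].
pose m := Num.min (e / 2) (p ord0 i / 2).
have [me mp] : m <= e / 2 /\ m <= p ord0 i / 2 by rewrite /m !ge_min !lexx orbT.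
have m0 : 0 < m by rewrite lt_min !divr_gt0.
have [d [u [d0 dm Du Qu pu]]] := pQ m m0.
have dui : d <= u ord0 i.
  case: (pu) => _ /(_ ord0 i); rewrite /ball /= ltr_norml => /andP[_]; lra.
have [q [sq lq uq]] := Qu i dui; exists q; split=> //; apply: eB.
apply: (@le_ball _ _ _ (m + d)); first by lra.
exact: ball_triangle pu uq.
Qed.

(** If the sets [G i] come within [e] of a common point for every [e], a limit
    of such points lies in all of them.  Otherwise, for some [e], label each
    point by an [i] such that it is [e]-away from [G i]; the point given by
    [simplex_labelling] contradicts the covering condition. *)
Theorem kkm (G : 'I_n.+1 -> set 'rV[R]_n.+1) :
  (forall i, closed (G i)) ->
  (forall p, simplex p -> exists2 i, 0 < p ord0 i & G i p) ->
  exists2 p, simplex p & forall i, G i p.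
Proof.
move=> Gcl Gcov.
pose Q e (u : 'rV[R]_n.+1) := forall i, exists2 q, G i q & ball u e q.
have [appr|/existsNP[e /not_implyP[e0 /forall2NP noQ]]] :=
    pselect (forall e, 0 < e -> exists2 u, simplex u & Q e u).
  have [p sp pQ] := @compact_approx R _ simplex Q simplex_compact appr.
  exists p => // i; apply: Gcl => B /nbhs_ballP[e e0 eB].
  have e20 : 0 < e / 2 by rewrite divr_gt0.
  have [d [u [d0 de Du Qu pu]]] := pQ _ e20; have [q Gq uq] := Qu i.
  exists q; split=> //; apply: eB.
  apply: (@le_ball _ _ _ (e / 2 + d)); first by lra.
  exact: ball_triangle pu uq.
have noG u : exists i, simplex u -> forall q, G i q -> ~ ball u e q.
  have [su|] := pselect (simplex u); last by exists ord0.
  have [//|/existsNP[i ni]] := noQ u; exists i => _ q Gq uq.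
  by apply: ni; exists q.
pose l u := sval (cid (noG u)).
have lP u : simplex u -> forall q, G (l u) q -> ~ ball u e q.
  by rewrite /l; case: cid.
have [p sp pl] := simplex_labelling l.
have [i pi0 Gp] := Gcov p sp.
have [u [[su lu] pu]] := pl i pi0 _ (nbhsx_ballx p e e0).
by case: (lP u su p); [rewrite lu | apply: ball_sym].
Qed.

End Simplex.

(** * Convex sets and topological vector spaces *)

Lemma convex_setP (R : realType) (X : lmodType R) (A : set X) :
  convex_set A <-> forall x y t, A x -> A y -> 0 <= t -> t <= 1 ->
    A (t *: x + (1 - t) *: y).
Proof.
split=> [cA x y t Ax Ay t0 t1|cA x y t].
  by have := cA x y (Itv01 t0 t1); rewrite !inE; apply.
by rewrite !inE => Ax Ay; apply: cA.
Qed.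

Definition barycenter (R : realType) (X : lmodType R) n (x : 'I_n -> X)
  (p : 'rV[R]_n) : X := \sum_i p ord0 i *: x i.

(** Only the points of positive weight have to lie in [A]; this is the form in
    which supports of points of the simplex are used. *)
Lemma convex_barycenter (R : realType) (X : lmodType R) (A : set X) n
    (x : 'I_n -> X) (p : 'rV[R]_n) :
  convex_set A -> simplex p -> (forall i, 0 < p ord0 i -> A (x i)) ->
  A (barycenter x p).
Proof.
move=> /convex_setP cA [p0 p1].
rewrite /barycenter; move: (p ord0) p0 p1 => {p}w.
elim: n x w => [|n IHn] x w w0.
  by rewrite big_ord0 => /esym/eqP; rewrite oner_eq0.
rewrite !big_ord_recl /= => w1 xA.
set s := \sum_i w (lift ord0 i) in w1; have s0 : 0 <= s by exact: sumr_ge0.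
have ws : w ord0 = 1 - s by lra.
have [s_eq0|s_neq0] := eqVneq s 0.
  have wi0 i : w (lift ord0 i) = 0.
    apply/eqP; have /eqP := s_eq0; rewrite psumr_eq0 // => /allP/(_ i).
    by apply; rewrite mem_index_enum.
  rewrite big1 => [|i _]; last by rewrite wi0 scale0r.
  by rewrite addr0 ws s_eq0 subr0 scale1r; apply: xA; rewrite ws s_eq0 subr0.
have sgt0 : 0 < s by rewrite lt_def s_neq0.
have Ay : A (\sum_i (w (lift ord0 i) / s) *: x (lift ord0 i)).
  apply: (IHn (fun i => x (lift ord0 i)) (fun i => w (lift ord0 i) / s)).
  - by move=> i; rewrite divr_ge0.
  - by rewrite -mulr_suml divff.
  - by move=> i wi; apply: xA; move: wi; rewrite pmulr_lgt0 ?invr_gt0.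
have -> : \sum_i w (lift ord0 i) *: x (lift ord0 i) =
    s *: \sum_i (w (lift ord0 i) / s) *: x (lift ord0 i).
  rewrite scaler_sumr; apply: eq_bigr => i _.
  by rewrite scalerA mulrCA divff ?mulr1.
move: (\sum_i (w _ / s) *: _) Ay => y Ay.
have [w00|w0_neq0] := eqVneq (w ord0) 0.
  have -> : s = 1 by lra.
  by rewrite w00 scale0r add0r scale1r.
have -> : s = 1 - w ord0 by lra.
apply: cA => //; first by apply: xA; rewrite lt_def w0_neq0 w0.
by lra.
Qed.

Lemma barycenter_hull (R : realType) (X : lmodType R) n (x y : 'I_n -> X)
    (p : 'rV[R]_n) :
  simplex p -> (forall i, 0 < p ord0 i -> range y (x i)) ->
  convex_hull (range y) (barycenter x p).
Proof. by move=> sp xy A [cA yA]; apply: convex_barycenter => // i /xy/yA. Qed.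

Lemma compact_finite_subcover (T : topologicalType) (C : set T)
    (O : T -> set T) :
  compact C -> C !=set0 -> (forall c, open (O c)) ->
  (forall y, C y -> exists2 c, C c & O c y) ->
  exists n (x : 'I_n.+1 -> T),
    (forall i, C (x i)) /\ forall y, C y -> exists i, O (x i) y.
Proof.
move=> Ccpt [c0 Cc0] Oo Ocov.
(* any point of [C] serves as the base point required of the space *)
pose T' : ptopologicalType := HB.pack T (isPointed.Build T c0).
have : compact (C : set T') by [].
rewrite compact_cover => /(_ T C O (fun c _ => Oo c) Ocov)[D DC Dcov].
(* [c0] is put in front so that the family is nonempty *)
pose x := c0 :: finmap.enum_fset D.
exists (size (finmap.enum_fset D)), (fun i => nth c0 x i); split.
  move=> [[|i] ilt] //=; apply/set_mem/DC.
  exact: (@mem_nth _ c0 (finmap.enum_fset D)).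
move=> y /Dcov[c /= cD Oy].
have ilt :
    ((index c (finmap.enum_fset D)).+1 < (size (finmap.enum_fset D)).+1)%N.
  by rewrite ltnS index_mem.
by exists (Ordinal ilt); rewrite /= nth_index.
Qed.

Section Tvs.
Variables (R : realType) (X : tvsType R).

Lemma tvs_cvgZ (T : Type) (F : set_system T) {FF : Filter F}
    (k : T -> R) (v : T -> X) (a : R) (y : X) :
  k x @[x --> F] --> a -> v x @[x --> F] --> y ->
  k x *: v x @[x --> F] --> a *: y.
Proof.
move=> ka vy.
apply: (@continuous2_cvg _ R^o X X F FF k v *:%R a y) => //.
exact: (@scale_continuous R X (a, y)).
Qed.

Lemma tvs_cvgD (T : Type) (F : set_system T) {FF : Filter F}
    (u v : T -> X) (a b : X) :
  u x @[x --> F] --> a -> v x @[x --> F] --> b ->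
  u x + v x @[x --> F] --> a + b.
Proof.
move=> ua vb; apply: (@continuous2_cvg _ X X X F FF u v +%R a b) => //.
exact: (@add_continuous X (a, b)).
Qed.

Lemma tvs_cvgB (T : Type) (F : set_system T) {FF : Filter F}
    (u v : T -> X) (a b : X) :
  u x @[x --> F] --> a -> v x @[x --> F] --> b ->
  u x - v x @[x --> F] --> a - b.
Proof.
move=> ua vb.
apply: (@continuous2_cvg _ X X X F FF u v (fun x y => x - y) a b) => //.
exact: (@sub_continuous X (a, b)).
Qed.

Lemma barycenter_continuous n (x : 'I_n -> X) : continuous (barycenter x).
Proof.
apply: continuous_big => [|i _ p]; first exact: add_continuous.
by apply: (@tvs_cvgZ _ (nbhs p)); [exact: coord_continuous|exact: cvg_cst].
Qed.

Lemma convex_closure (A : set X) : convex_set A -> convex_set (closure A).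
Proof.
move=> /convex_setP cA; apply/convex_setP => x y t Ax Ay t0 t1 B nB.
have cont : continuous (fun z : X * X => t *: z.1 + (1 - t) *: z.2).
  move=> z; apply: tvs_cvgD; apply: tvs_cvgZ; try exact: cvg_cst.
    exact: cvg_fst.
  exact: cvg_snd.
have [[U V] /= [Ux Vy] UVB] := cont (x, y) B nB.
have [x' [Ax' Ux']] := Ax U Ux; have [y' [Ay' Vy']] := Ay V Vy.
by exists (t *: x' + (1 - t) *: y'); split; [exact: cA|exact: (UVB (x', y'))].
Qed.

(** Local convexity and regularity together: the closure in the conclusion is
    needed because only closures survive the limit in [simplex_labelling]. *)
Lemma convex_nbhs0 (A : set X) : nbhs 0 A ->
  exists W : set X, [/\ convex_set W, open W, W 0 & closure W `<=` A].
Proof.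
move=> A0; have [B Bconv [Bopen Bbase]] := @locally_convex R X.
have [V V0 VA] := @uniform_regular X 0 A A0.
have [W [BW W0] WV] := Bbase 0 V V0.
exists W; split=> //; first by apply: Bconv; rewrite inE.
  exact: Bopen.
exact: subset_trans (closureS WV) VA.
Qed.

(** Without a fixed point, the compact set of the differences [y - x], for
    [(x, y)] in the graph, avoids 0, hence avoids the closure of some convex
    neighbourhood [W] of 0.  Labelling the simplex spanned by a finite [W]-net
    of [C] produces such a difference in the closure of [W]. *)
Theorem fan_glicksberg (C : set X) (M : X -> set X) :
  hausdorff_space X ->
  compact C -> convex_set C -> C !=set0 ->
  (forall x, C x -> M x `<=` C) -> (forall x, C x -> M x !=set0) ->
  (forall x, C x -> convex_set (M x)) ->
  closed [set p : X * X | C p.1 /\ M p.1 p.2] ->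
  exists2 x, C x & M x x.
Proof.
move=> X_hausdorff Ccpt Cconv C0 MC M0 Mconv.
set gr := [set p : X * X | _] => grcl.
have grcpt : compact gr.
  apply: subclosed_compact grcl (compact_setX Ccpt Ccpt) _ => p [Cp Mp].
  by split => //=; apply: MC Mp.
apply: contrapT => nofix.
pose diffs := (fun p : X * X => p.2 - p.1) @` gr.
have diffs_closed : closed diffs.
  apply: compact_closed => //; apply: continuous_compact => //.
  apply: continuous_subspaceT => p.
  by apply: tvs_cvgB; [exact: cvg_snd|exact: cvg_fst].
have diffs0 : nbhs 0 (~` diffs).
  apply: open_nbhs_nbhs; split; first exact: closed_openC.
  move=> [[x y] /= [Cx Mxy] /eqP]; rewrite subr_eq0 => /eqP yx.
  by apply: nofix; exists x => //; rewrite -{2}yx.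
have [W [Wconv Wo W0 Wdiffs]] := convex_nbhs0 diffs0.
have [||n [x [Cx xcov]]] :=
    @compact_finite_subcover _ C (fun c => [set y | W (y - c)]) Ccpt C0.
- move=> c; apply: (open_comp (f := fun y => y - c) (D := W)) => // y _.
  by apply: tvs_cvgB; [exact: cvg_id|exact: cvg_cst].
- by move=> y Cy; exists y => //=; rewrite subrr.
have Cbar p : simplex p -> C (barycenter x p).
  by move=> sp; apply: convex_barycenter.
have lab p : exists i,
    simplex p -> exists2 y, M (barycenter x p) y & W (y - x i).
  have [sp|] := pselect (simplex p); last by exists ord0.
  have [y My] := M0 _ (Cbar p sp).
  have [i Wi] := xcov y (MC _ (Cbar p sp) _ My).
  by exists i => _; exists y.
pose l p := sval (cid (lab p)).
have lP p : simplex p -> exists2 y, M (barycenter x p) y & W (y - x (l p)).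
  by rewrite /l; case: cid.
have [p sp pl] := simplex_labelling l.
(* being labelled [i] entails a closed condition, so it holds in the limit *)
pose good i :=
  [set q | exists2 y, gr (barycenter x q, y) & closure W (y - x i)].
have good_closed i : closed (good i).
  have -> : good i =
      barycenter x @^-1`
        (fst @` (gr `&` [set z : X * X | closure W (z.2 - x i)])).
    apply/seteqP; split=> [q [y gqy Wy]|q [[a b] [/= gab Wb] aq]].
      by exists (barycenter x q, y).
    by exists b; rewrite // -aq.
  apply: preimage_closed; first by move=> q _; exact: barycenter_continuous.
  apply: compact_closed => //; apply: continuous_compact.
    by apply: continuous_subspaceT => z; exact: cvg_fst.
  apply: compact_closedI => //.
  apply: (@preimage_closed _ _ (fun z : X * X => z.2 - x i)).
    by move=> z _; apply: tvs_cvgB; [exact: cvg_snd|exact: cvg_cst].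
  exact: closed_closure.
have image_near i : exists y, 0 < p ord0 i ->
    M (barycenter x p) y /\ closure W (y - x i).
  have [pi0|_] := boolP (0 < p ord0 i); last by exists 0.
  suff [y [_ My] Wy] : good i p by exists y.
  apply: good_closed; apply: closureS (pl i pi0) => q [sq <-].
  have [y My Wy] := lP q sq; exists y; last exact: subset_closure.
  by split=> //=; exact: Cbar.
pose y i := sval (cid (image_near i)).
have yP i : 0 < p ord0 i -> M (barycenter x p) (y i) /\ closure W (y i - x i).
  by rewrite /y; case: cid.
have My : M (barycenter x p) (barycenter y p).
  by apply: convex_barycenter => // [|i /yP[]//]; apply/Mconv/Cbar.
have Wy : closure W (barycenter y p - barycenter x p).
  rewrite /barycenter -sumrB; under eq_bigr do rewrite -scalerBr.
  apply: (@convex_barycenter _ _ (closure W) _ (fun i => y i - x i) p) => //.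
    exact: convex_closure.
  by move=> i /yP[].
apply: (Wdiffs _ Wy); exists (barycenter x p, barycenter y p) => //.
by split=> //=; exact: Cbar.
Qed.

(** By compactness finitely many of the sets [F y] are enough, and [kkm] applies
    to their preimages in a simplex. *)
Theorem ky_fan_kkm (D : set X) (F : X -> set X) :
  compact D -> convex_set D -> D !=set0 -> (forall y, closed (F y)) ->
  (forall n (x : 'I_n.+1 -> X) z, (forall i, D (x i)) ->
    convex_hull (range x) z -> exists i, F (x i) z) ->
  exists2 z, D z & forall y, D y -> F y z.
Proof.
move=> Dcpt Dconv D0 Fcl Fkkm; apply: contrapT => noz.
have [||n [x [Dx xcov]]] :=
    @compact_finite_subcover _ D (fun y => ~` F y) Dcpt D0.
- by move=> y; exact: closed_openC.
- move=> z Dz; apply: contrapT => noy; apply: noz; exists z => // y Dy.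
  by apply: contrapT => nFy; apply: noy; exists y.
have [|p sp|p sp pF] := @kkm R n (fun i => barycenter x @^-1` F (x i)).
- by move=> i; apply: preimage_closed => // p _; exact: barycenter_continuous.
- have [j pj0] := simplex_support sp.
  (* repeating a point of positive weight drops the points of weight 0 *)
  pose x' i := if 0 < p ord0 i then x i else x j.
  have [i| |i] := Fkkm n x' (barycenter x p); first by rewrite /x'; case: ifP.
    by apply: barycenter_hull => // i pi0; exists i; rewrite // /x' pi0.
  rewrite /x'; case: ifP => [pi0 Fi|_ Fj]; first by exists i.
  by exists j.
have Dp : D (barycenter x p) by apply: convex_barycenter.
by have [i] := xcov _ Dp; apply; exact: pF.
Qed.

End Tvs.

(** * Quasi-equilibria *)

Theorem theorem2p2 (R : realType) (X : tvsType R) (C : set X)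
    (f : X -> X -> R) (K : X -> set X)
    (X_hausdorff : hausdorff_space X)
    (C_compact : compact C)
    (C_convex : convex_set C)
    (C_nonempty : C !=set0)
    (K_map : set_valued_map C K)
    (K_nonempty : forall x, C x -> K x !=set0)
    (K_closed : closed_map C K)
    (K_lsc : lower_semicontinuous_map C K)
    (K_convex : forall x, C x -> convex_set (K x))
    (f_convex : forall y, C y -> convex_set [set x | C x /\ 0 <= f x y])
    (f_max : forall (n : nat) (xs : 'I_n.+1 -> X) (x : X),
       (forall i, C (xs i)) -> convex_hull (range xs) x ->
       0 <= \big[Num.max/f x (xs ord0)]_(i < n.+1) f x (xs i))
    (f_closed : closed ([set p : X * X | (C `*` C) p /\ 0 <= f p.1 p.2]
                          : set (subspace (C `*` C)))) :
  QEP C f K !=set0.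
Proof.
have C_closed : closed C by exact: compact_closed.
have CC_closed : closed (C `*` C).
  have -> : C `*` C = fst @^-1` C `&` snd @^-1` C by [].
  by apply: closedI; apply: preimage_closed => // p _;
    [exact: cvg_fst|exact: cvg_snd].
have closed_of_subspace (P : set (X * X)) : P `<=` C `*` C ->
    closed (P : set (subspace (C `*` C))) -> closed P.
  move=> PC /closed_subspaceP[V Vcl VP].
  by rewrite -(setIidl PC) -VP; exact: closedI.
have {K_closed}K_closed : closed [set p | (C `*` C) p /\ K p.1 p.2].
  by apply: closed_of_subspace K_closed => p [].
have {f_closed}f_closed : closed [set p | (C `*` C) p /\ 0 <= f p.1 p.2].
  by apply: closed_of_subspace f_closed => p [].
pose M x := [set z | K x z /\ forall y, K x y -> 0 <= f z y].
have [x Cx [Kx fx]] : exists2 x, C x & M x x.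
  apply: fan_glicksberg => //.
  - by move=> x Cx z [Kz _]; exact: K_map Kz.
  - move=> x Cx; have KC := K_map x Cx.
    (* the premise [C y] makes the set closed for every [y] of the space *)
    pose F y := [set z | C y -> C z /\ 0 <= f z y].
    have Fcl y : closed (F y).
      have [Cy|nCy] := pselect (C y); last first.
        by have -> : F y = setT by apply/seteqP; split.
      have -> : F y = (fun z => (z, y)) @^-1`
          [set p | (C `*` C) p /\ 0 <= f p.1 p.2].
        by apply/seteqP; split=> z /=; [move=> /(_ Cy)[]|move=> [[]]].
      apply: preimage_closed => // z _.
      by apply: cvg_pair; [exact: cvg_id|exact: cvg_cst].
    have K_cpt : compact (K x).
      apply: (subclosed_compact _ C_compact KC).
      have -> : K x = (fun y => (x, y)) @^-1`
          [set p | (C `*` C) p /\ K p.1 p.2].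
        by apply/seteqP; split=> y /= => [Ky|[]//]; do !split => //; exact: KC.
      apply: preimage_closed => // z _.
      by apply: cvg_pair; [exact: cvg_cst|exact: cvg_id].
    have [|z Kz Fz] :=
        ky_fan_kkm K_cpt (K_convex x Cx) (K_nonempty x Cx) Fcl.
      move=> n xs z Kxs zhull; apply: contrapT => noF.
      have Cz : C z by apply: zhull; split=> // _ [i _ <-]; exact/KC.
      have neg i : f z (xs i) < 0.
        by rewrite ltNge; apply/negP => fz; apply: noF; exists i.
      have := f_max n xs z (fun i => KC _ (Kxs i)) zhull.
      rewrite leNgt => /negP; apply; elim/big_ind: _ => // a b a0 b0.
      by rewrite gt_max a0.
    by exists z; split=> // y Ky; apply: (Fz y Ky _).2; exact: KC.
  - move=> x Cx; apply/convex_setP => a b t [Ka fa] [Kb fb] t0 t1.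
    have KC := K_map x Cx; have /convex_setP Kx := K_convex x Cx.
    split=> [|y Ky]; first exact: Kx.
    have /convex_setP fy := f_convex y (KC y Ky).
    by apply: (fy a b t _ _ t0 t1).2; split; rewrite ?fa ?fb //; exact: KC.
  - move=> [x z] clM.
    have [[/= Cx Cz] Kxz] : (C `*` C) (x, z) /\ K x z.
      apply: K_closed; apply: closureS clM => -[x' z'] [/= Cx' [Kz' _]].
      by split=> //; split=> //=; exact: (K_map x').
    split=> //=; split=> // y Kxy; have Cy := K_map x Cx y Kxy.
    apply: contrapT => nfzy.
    have : nbhs (z, y) (~` [set p | (C `*` C) p /\ 0 <= f p.1 p.2]).
      by apply: open_nbhs_nbhs; split; [exact: closed_openC|case].
    move=> [[U V] /= [Uz Vy] UV].
    have /open_subspaceP[G Go GE] := K_lsc (V°) (open_interior V).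
    have Gx : G x.
      suff [] : (G `&` C) x by [].
      by rewrite GE; do !split => //; exists y; split.
    have [|[x' z'] [[/= Cx' [Kz' fz']] [/= Ox' Uz']]] := clM (G `*` U).
      by exists (G, U) => //; split=> //=; exact: open_nbhs_nbhs.
    have [[_ [y' [Ky' Vy']]] _] :
        ([set x | C x /\ K x `&` V° !=set0] `&` C) x' by rewrite -GE.
    apply: (UV (z', y')); first by split => //=; exact: interior_subset.
    by do !split => //=; [exact: K_map Kz'|exact: K_map Ky'|exact: fz'].
by exists x; split.
Qed.
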